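(* Let $\mathscr{I}$ be a non-empty set. For each $i\in\mathscr{I}$ let $\lambda_i\geqslant 1$ be a cardinal, let $S_i$ be a Hausdorff pseudocompact semitopological monoid with zero, and let $\big(B^0_{\lambda_i}(S_i),\tau^0_{B(S_i)}\big)$ be a Hausdorff pseudocompact topological Brandt $\lambda_i^0$-extension of $S_i$. Suppose that the Tychonoff product $\prod\{S_i\colon i\in\mathscr{I}\}$ is a pseudocompact space. Then the direct product $\prod\big\{\big(B^0_{\lambda_i}(S_i),\tau^0_{B(S_i)}\big)\colon i\in\mathscr{I}\big\}$ with the Tychonoff topology is a Hausdorff pseudocompact semitopological semigroup.
   Context: All topological spaces are Hausdorff. A semitopological semigroup is a Hausdorff topological space with a separately continuous associative operation; a semitopological monoid is a semitopological semigroup with identity. Direct products of semigroups carry the coordinatewise operation. Brandt $\lambda^0$-extension: for a monoid $S$ with zero $0_S$ and a cardinal $\lambda\geqslant 1$, $B^0_\lambda(S)$ is the set $\{(\alpha,s,\beta)\colon \alpha,\beta\in\lambda,\ s\in S\setminus\{0_S\}\}\sqcup\{0\}$ with the operation in which $0$ is the zero and $(\alpha,a,\beta)\cdot(\gamma,b,\delta)$ equals $(\alpha,ab,\delta)$ if $\beta=\gamma$ and $ab\neq 0_S$, and equals $0$ otherwise. For $\alpha,\beta\in\lambda$ put $S_{\alpha,\beta}=\{(\alpha,s,\beta)\colon s\in S\setminus\{0_S\}\}\cup\{0\}$. Topological Brandt $\lambda^0$-extension: for a semitopological monoid $(S,\tau)$ with zero, it is $B^0_\lambda(S)$ with a Hausdorff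 topology $\tau_B$ such that $(B^0_\lambda(S),\tau_B)$ is a semitopological semigroup and, for some $\alpha\in\lambda$, the map $0_S\mapsto 0$, $s\mapsto(\alpha,s,\alpha)$ ($s\neq 0_S$) is a homeomorphism of $(S,\tau)$ onto the subspace $S_{\alpha,\alpha}$. A Hausdorff space is pseudocompact if every locally finite family of non-empty open subsets of it is finite (equivalently, each locally finite open cover is finite); no Tychonoff separation is assumed. *)

(* Defs.v *)
From HB Require Import structures.
From mathcomp Require Import all_boot.
From mathcomp Require Import all_classical topology.

Set Implicit Arguments.
Unset Strict Implicit.
Unset Printing Implicit Defensive.

Local Open Scope classical_set_scope.
Local Open Scope group_scope.

HB.mixin Record Monoid_hasZero S of monoid.Monoid S := {
  mzero : S;
  mul0s : left_zero mzero (@mul S);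
  muls0 : right_zero mzero (@mul S);
}.

#[short(type="monoid0Type")]
HB.structure Definition Monoid0 :=
  {S of Monoid_hasZero S & monoid.Monoid S}.

(* Types carrying both a topology and a semigroup (resp. monoid with zero)
   structure; no compatibility between the two is required here. *)
#[short(type="preTopologicalSemigroupType")]
HB.structure Definition PreTopologicalSemigroup :=
  {S of Topological S & Semigroup S}.

#[short(type="preTopologicalMonoid0Type")]
HB.structure Definition PreTopologicalMonoid0 :=
  {S of Topological S & Monoid0 S}.

Definition semitopological_semigroup (S : preTopologicalSemigroupType) : Prop :=
  [/\ hausdorff_space S,
      forall a : S, continuous (fun x : S => a * x) &
      forall a : S, continuous (fun x : S => x * a)].

Definition locally_finite (X : topologicalType) (F : set (set X)) : Prop :=
  forall x : X, exists2 N : set X, nbhs x N &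
    finite_set [set A | F A /\ A `&` N !=set0].

Definition pseudocompact (X : topologicalType) : Prop :=
  forall F : set (set X),
    (forall A, F A -> open A /\ A !=set0) -> locally_finite F -> finite_set F.

Definition homeomorphism (X Y : topologicalType) (f : X -> Y) : Prop :=
  continuous f /\ exists g : Y -> X, [/\ continuous g, cancel f g & cancel g f].

Record topology_on (X : Type) := TopologyOn {
  is_open : set_system X;
  is_openT : is_open setT;
  is_openI : setI_closed is_open;
  is_open_bigU : forall (J : Type) (f : J -> set X),
    (forall j, is_open (f j)) -> is_open (\bigcup_j f j);
}.

Definition with_topology (X : Type) (tau : topology_on X) : Type := X.

HB.instance Definition _ (X : choiceType) (tau : topology_on X) :=
  Choice.copy (with_topology tau) X.
HB.instance Definition _ (X : choiceType) (tau : topology_on X) :=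
  isOpenTopological.Build (with_topology tau)
    (@is_openT X tau) (@is_openI X tau) (@is_open_bigU X tau).
HB.instance Definition _ (X : semigroupType) (tau : topology_on X) :=
  Semigroup.copy (with_topology tau) X.

Section ProductSemigroup.
Context {I : Type} (S : I -> preTopologicalSemigroupType).

Definition prod_mul (x y : prod_topology S) : prod_topology S :=
  fun i => x i * y i.

Lemma prod_mulA : associative prod_mul.
Proof. by move=> x y z; apply: functional_extensionality_dep => i; exact: mulgA. Qed.

HB.instance Definition _ :=
  isSemigroup.Build (prod_topology S) prod_mulA.

End ProductSemigroup.

Section Brandt.
Context (L : choiceType) (S : monoid0Type).

Definition nonzero := {s : S | s != mzero}.

(* [None] is the zero of the extension. *)
Definition brandt : Type := option (L * nonzero * L).

HB.instance Definition _ := Choice.on brandt.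

(* The triple (a, s, b), read as the zero of the extension if s is zero. *)
Definition triple (a : L) (s : S) (b : L) : brandt :=
  if insub s is Some u then Some (a, u, b) else None.

Definition brandt_mul (x y : brandt) : brandt :=
  match x, y with
  | Some (a, s, b), Some (c, t, d) =>
      if b == c then triple a (val s * val t) d else None
  | _, _ => None
  end.

Lemma brandt_mulA : associative brandt_mul.
Proof.
have tripleM a s b (y : nonzero) c d :
    brandt_mul (triple a s b) (Some (c, y, d)) =
    if b == c then triple a (s * val y) d else None.
  rewrite /triple; case: insubP => [u _ <-//|/negPn/eqP ->] /=.
  by rewrite mul0s insubF ?eqxx//; case: ifP.
have Mtriple a s b (y : nonzero) c d :
    brandt_mul (Some (c, y, d)) (triple a s b) =
    if d == a then triple c (val y * s) b else None.
  rewrite /triple; case: insubP => [u _ <-//|/negPn/eqP ->] /=.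
  by rewrite muls0 insubF ?eqxx//; case: ifP.
have nullr x : brandt_mul x None = None by case: x => [[[]]|].
move=> [[[a s] b]|]// [[[c t] d]|]// [[[e u] f]|]; last by rewrite !nullr.
rewrite [brandt_mul (Some (c, t, d)) _]/= [brandt_mul (Some (a, s, b)) (Some _)]/=.
have [de|de] := eqVneq d e; have [bc|bc] := eqVneq b c => //.
- by rewrite tripleM Mtriple de bc !eqxx mulgA.
- by rewrite Mtriple (negbTE bc).
- by rewrite tripleM (negbTE de).
Qed.

HB.instance Definition _ := isSemigroup.Build brandt brandt_mulA.

Definition corner (a b : L) : set brandt :=
  [set Some (a, s, b) | s in [set: nonzero]] `|` [set None].

Lemma triple_corner a s b : corner a b (triple a s b).
Proof. by rewrite /triple; case: insubP => [u _ _|_]; [left; exists u|right]. Qed.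

End Brandt.

Section TopologicalBrandt.
Context (L : choiceType) (S : preTopologicalMonoid0Type).
Context (tau : topology_on (brandt L S)).

(* [corner a b] with the subspace topology induced by [tau]. *)
Definition corner_space (a b : L) : topologicalType :=
  set_type (corner a b : set (with_topology tau)).

Definition corner_map (a : L) (s : S) : corner_space a a :=
  SigSub (mem_set (triple_corner a s a)).

Definition topological_brandt_extension : Prop :=
  semitopological_semigroup (with_topology tau) /\
  exists a : L, homeomorphism (corner_map a).

End TopologicalBrandt.

(* Main.v *)
Require Import Defs.
From mathcomp Require Import all_boot finmap all_classical topology.

(** Let B be a pseudocompact topological Brandt extension of S.  For each pair
    p = (a, b) of indices the chart s |-> (a, s, b) is a continuous map from S
    onto the corner S_(a, b), because it is obtained from the given embedding
    into one diagonal corner by a left and a right translation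
    ([triple_continuous]).  The nonzero part of every corner is open, so
    pseudocompactness of B forces every neighbourhood of 0 to be dense in all
    but finitely many corners ([finite_corner_not_closure]).  Thus B behaves
    like a family of copies of S glued at 0: when the index p leaves every finite
    set, the whole copy tends to 0, in the weak sense that it enters the closure
    of every neighbourhood of 0.

    This is all that is needed for products ([pseudocompact_prod_charts]).  Let
    F be an infinite family of nonempty open sets of the product of the B_i.
    For A in F choose charts p_(A, i), one for each i, whose product has a value
    in A, and let V_A be the preimage of A in the product of the S_i.  The sets V_A
    accumulate at some point s, since the product of the S_i is pseudocompact.
    Follow the accumulation along an ultrafilter on F: for each i, either
    p_(A, i) is equal to a fixed chart q for most A, and the limit in B_i is
    the point q(s_i), or p_(A, i) leaves every finite set of charts, and the
    limit is 0.  A neighbourhood of the limit point constrains only finitely many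
    coordinates, so for most A some point of A lies in its closure and A, being
    open, meets it: F is not locally finite.  The ultrafilter
    replaces the compactness of the product of the one-point compactifications
    of the discrete sets of charts. *)

Set Implicit Arguments.
Unset Strict Implicit.
Unset Printing Implicit Defensive.

Local Open Scope classical_set_scope.
Local Open Scope group_scope.

(** * Product topologies *)

Lemma filter_finite_bigcap (T : Type) (I : choiceType) (F : set_system T)
    (D : set I) (f : I -> set T) :
  Filter F -> finite_set D -> (forall i, D i -> F (f i)) ->
  F (\bigcap_(i in D) f i).
Proof.
move=> FF fD Ff; rewrite -(fset_setK fD).
by apply: filter_bigI => i; rewrite in_fset_set // inE => /Ff.
Qed.

Lemma continuous_into_product (I : choiceType) (T : topologicalType)
    (X : I -> topologicalType) (f : T -> prod_topology X) :
  (forall i, continuous (fun t => f t i)) -> continuous f.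
Proof.
move=> fc t; apply/cvg_sup => i A [_ [[B oB <-] Bft] BA].
apply: filterS BA _; apply: (fc i t).
exact: open_nbhs_nbhs.
Qed.

Lemma nbhs_prod_box (I : choiceType) (X : I -> topologicalType)
    (x : prod_topology X) (N : set (prod_topology X)) :
  nbhs x N -> exists D : set I, exists O : forall i, set (X i),
    [/\ finite_set D, forall i, nbhs (x i) (O i) &
        forall y : prod_topology X, (forall i, D i -> O i (y i)) -> N y].
Proof.
(* The sets containing a box around x form a filter, and convergence to x in
   a product can be tested on each coordinate. *)
pose F : set_system (prod_topology X) := [set M | exists D : set I,
  exists O : forall i, set (X i), [/\ finite_set D, forall i, nbhs (x i) (O i)
  & forall y, (forall i, D i -> O i (y i)) -> M y]].
have FF : Filter F.
  split.
  - by exists set0, (fun=> setT); split=> // i; exact: filterT.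
  - move=> M N' [D [O [Df On OM]]] [D' [O' [Df' On' OM']]].
    exists (D `|` D'), (fun i => O i `&` O' i); split.
    + by rewrite finite_setU.
    + by move=> i; exact: filterI.
    + move=> y yDO; split; [apply: OM|apply: OM'] => i Di.
        by have [] := yDO i (or_introl Di).
      by have [] := yDO i (or_intror Di).
  - move=> M N' MN [D [O [Df On OM]]]; exists D, O; split=> // y /OM.
    exact: MN.
suff : F --> x by move=> /(_ N).
apply/cvg_sup => i A [_ [[B oB <-] Bxi] BA].
(* The set B lives in the factor X i; on a coordinate j it has to be transported
   along a proof of j = i, and it puts no condition when there is none. *)
exists [set i], (fun j => [set z | forall e : j = i, B (ecast j (X j) e z)]).
split; first exact: finite_set1.
- move=> j; have [e|ji] := pselect (j = i).
    have jB : nbhs (x j) (fun z => B (ecast j (X j) e z)).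
      by case: i / e B oB Bxi {BA} => B oB Bxi; exact: open_nbhs_nbhs.
    by apply: filterS jB => z Bz e'; rewrite (Prop_irrelevance e' e).
  by apply: filterS filterT => z _ e; case: ji.
- by move=> y /(_ i erefl erefl); exact: BA.
Qed.

(** A contains a box around y, whose side of index i meets O i for every i in D;
    the coordinates of z can be chosen one at a time in these intersections. *)
Lemma closure_prod_box (I : choiceType) (X : I -> topologicalType)
    (D : set I) (O : forall i, set (X i)) (y : prod_topology X)
    (A : set (prod_topology X)) :
  nbhs y A -> (forall i, D i -> closure (O i) (y i)) ->
  exists2 z, A z & forall i, D i -> O i (z i).
Proof.
move=> /nbhs_prod_box[D' [O' [_ nO' OA]]] yO.
have /(_ _)/cid z i : exists z, O' i z /\ (D i -> O i z).
  have [Di|nDi] := pselect (D i).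
    by have [z [Oz O'z]] := yO i Di _ (nO' i); exists z.
  by exists (y i); split=> //; exact: nbhs_singleton.
exists (fun i => projT1 (z i)).
  by apply: OA => i _; case: (projT2 (z i)).
by move=> i; case: (projT2 (z i)).
Qed.

(** * Accumulation in pseudocompact spaces *)

(** Pseudocompactness speaks of sets of open sets; families indexed by D are
    needed, in which the same set may occur many times.  A locally finite
    indexed family of nonempty sets repeats each of them finitely often, so the
    two versions agree. *)
Lemma pseudocompact_accumulation (X : topologicalType) (T : Type) (D : set T)
    (V : T -> set X) :
  pseudocompact X -> infinite_set D ->
  (forall d, D d -> open (V d) /\ V d !=set0) ->
  exists x : X,
    forall N, nbhs x N -> infinite_set [set d | D d /\ V d `&` N !=set0].
Proof.
move=> pX Dinf VD; apply: contrapT => /forallNP noacc; apply: Dinf.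
have {noacc}lf (x : X) : exists2 N, nbhs x N &
    finite_set [set d | D d /\ V d `&` N !=set0].
  by have /existsNP[N /not_implyP[xN /contrapT fN]] := noacc x; exists N.
have imfin : finite_set (V @` D).
  apply: pX => [_ [d /VD ? <-]//|x].
  have [N xN fN] := lf x; exists N => //.
  apply: sub_finite_set (finite_image V fN).
  by move=> _ [[d Dd <-] VN]; exists d.
have -> : D = \bigcup_(W in V @` D) [set d | D d /\ V d = W].
  apply/seteqP; split=> [d Dd|d [_ _ []//]].
  by exists (V d) => //; exists d.
apply: bigcup_finite => // _ [d Dd <-].
have [_ [x Vx]] := VD d Dd; have [N xN fN] := lf x.
apply: sub_finite_set fN => e /= [De ->]; split=> //.
by exists x; split=> //; exact: nbhs_singleton.
Qed.

(** Each X i is covered by charts h i p with the same domain Y i, and the charts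
    converge to x0 i, up to closures, as p leaves the finite sets.  Hence a
    sequence of points h i (p_n) (y_n), with y_n accumulating at y, clusters
    at h i q y if p_n is constantly q, and at x0 i if p_n leaves every finite
    set; an ultrafilter imposes this alternative in all coordinates at once. *)
Lemma pseudocompact_prod_charts (I : choiceType) (P : I -> choiceType)
    (Y X : I -> topologicalType) (h : forall i, P i -> Y i -> X i)
    (x0 : forall i, X i) :
  (forall i p, continuous (h i p)) ->
  (forall i x, exists p y, h i p y = x) ->
  (forall i O, nbhs (x0 i) O ->
     finite_set [set p | ~ range (h i p) `<=` closure O]) ->
  pseudocompact (prod_topology Y) -> pseudocompact (prod_topology X).
Proof.
move=> hc hsurj hfin pY F Fo Flf; apply: contrapT => Finf.
(* c A i is the chart of X i chosen for the member A of F *)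
have /choice[c cP] : forall A, exists c : forall i, P i, F A ->
    exists t : prod_topology Y, A (fun i => h i (c i) (t i)).
  move=> A; have [FA|nFA] := pselect (F A); last first.
    have [A0 FA0] := infinite_setN0 Finf; have [_ [a _]] := Fo _ FA0.
    by exists (fun i => projT1 (cid (hsurj i (a i)))) => /nFA.
  have [_ [a Aa]] := Fo _ FA.
  pose q i := cid (hsurj i (a i)); pose t i := cid (projT2 (q i)).
  exists (fun i => projT1 (q i)) => _; exists (fun i => projT1 (t i)).
  suff -> : (fun i => h i (projT1 (q i)) (projT1 (t i))) = a by [].
  by apply: functional_extensionality_dep => i; exact: (projT2 (t i)).
pose H A : prod_topology Y -> prod_topology X := fun t i => h i (c A i) (t i).
have Hc A : continuous (H A).
  apply: continuous_into_product => i t.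
  apply: (@continuous_comp (prod_topology Y) (Y i) (X i)
    (proj i) (h i (c A i))); first exact: proj_continuous.
  exact: hc.
pose V A := H A @^-1` A.
have VF A : F A -> open (V A) /\ V A !=set0.
  move=> FA; split; last exact: cP.
  by apply: open_comp => [? _|]; [exact: Hc|have [] := Fo A FA].
have [s sacc] := pseudocompact_accumulation pY Finf VF.
(* The sets B (N, E), with N a neighbourhood of s and E finite, form a base of a
   filter: the members of F outside of E whose V meets N. *)
pose B (NE : set (prod_topology Y) * set (set (prod_topology X))) :=
  [set A | [/\ F A, ~ NE.2 A & V A `&` NE.1 !=set0]].
have : ProperFilter (filter_from
    [set NE | nbhs s NE.1 /\ finite_set NE.2] B).
  apply: filter_from_proper; last first.
    move=> [N E] [/= sN fE].
    have /infinite_setN0[A [[FA VN] nEA]] := infinite_setD (sacc N sN) fE.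
    by exists A.
  apply: filter_from_filter.
    by exists (setT, set0); split=> //=; exact: filterT.
  move=> [N E] [N' E'] [/= sN fE] [/= sN' fE'].
  exists (N `&` N', E `|` E').
    by split; [exact: filterI|rewrite finite_setU].
  move=> A [/= FA nEA [t [Vt [Nt N't]]]].
  by split; split=> //=; (try by exists t); apply: contra_not nEA;
    [left|right].
move=> /ultraFilterLemma[U [Uultra BU]].
(* The limit in X i: O can be any neighbourhood, and M is the condition on the
   argument of the chart that puts its value in the closure of O for most A. *)
have /(_ _)/cid x i : exists x : X i, forall O, nbhs x O ->
    exists2 M, nbhs (s i) M &
      U [set A | forall t, M t -> closure O (h i (c A i) t)].
  have [[q Uq]|nq] := pselect (exists q, U [set A | c A i = q]).
    exists (h i q (s i)) => O qO; exists (h i q @^-1` O); first exact: hc.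
    by apply: filterS Uq => A /= -> t Ot; exact: subset_closure.
  exists (x0 i) => O /hfin fE; exists setT; first exact: filterT.
  have Uall : U (\bigcap_(p in [set p | ~ range (h i p) `<=` closure O])
      [set A | c A i <> p]).
    apply: filter_finite_bigcap => // p _.
    have [Up|//] := in_ultra_setVsetC [set A | c A i = p] Uultra.
    by case: nq; exists p.
  apply: filterS Uall => A UA t _.
  apply: contrapT => nO; apply: (UA (c A i)) => //= hO.
  by apply: nO; apply: hO; exists t.
pose x' : prod_topology X := fun i => projT1 (x i).
(* The finitely many members of F meeting W are excluded by the ultrafilter,
   while most members of F meet W. *)
have [W xW fW] := Flf x'.
have [D [O [fD nO OW]]] := nbhs_prod_box xW.
have /(_ _)/cid2 M i := projT2 (x i) (O i) (nO i).
pose N : set (prod_topology Y) :=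
  \bigcap_(i in D) (proj i @^-1` s2val (M i)).
have sN : nbhs s N.
  apply: filter_finite_bigcap => // i _; apply: proj_continuous.
  exact: (s2valP (M i)).
have UN : U (B (N, [set A | F A /\ A `&` W !=set0])).
  by apply: BU; exists (N, [set A | F A /\ A `&` W !=set0]).
have UD : U (\bigcap_(i in D)
    [set A | forall t, s2val (M i) t -> closure (O i) (h i (c A i) t)]).
  by apply: filter_finite_bigcap => // i _; exact: (s2valP' (M i)).
have [A [[/= FA nW [t [At Nt]]] Ac]] := filter_ex (filterI UN UD).
apply: nW; split=> //.
have nA : nbhs (H A t) A by apply: open_nbhs_nbhs; have [] := Fo A FA.
have [|z Az zO] := closure_prod_box (D := D) (O := O) nA.
  by move=> i Di; apply: (Ac i Di); exact: Nt.
by exists z; split=> //; exact: OW.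
Qed.

(** * Topological Brandt extensions *)

Lemma semitopological_translations (S : preTopologicalSemigroupType) (a b : S) :
  semitopological_semigroup S -> continuous (fun x : S => a * x * b).
Proof.
move=> [_ lc rc] x.
exact: (@continuous_comp S S S (fun x => a * x) (fun x => x * b) x
  (lc a x) (rc b _)).
Qed.

Section BrandtExtension.
Context (L : choiceType) (S : preTopologicalMonoid0Type).
Context (tau : topology_on (brandt L S)).
Local Notation B := (with_topology tau).

Lemma triple_val (a b : L) (u : nonzero S) :
  triple a (val u) b = Some (a, u, b).
Proof. by rewrite /triple valK. Qed.

Lemma triple0 (a b : L) : triple a (mzero : S) b = None.
Proof. by rewrite /triple insubF // eqxx. Qed.

Lemma tripleM (a b c : L) (s t : S) :
  (triple a s b : B) * (triple b t c : B) = triple a (s * t) c :> B.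
Proof.
have [->|s0] := eqVneq s mzero; first by rewrite mul0s !triple0.
have [->|t0] := eqVneq t mzero.
  by rewrite muls0 !triple0; case: (triple a s b) => [[[]]|].
by rewrite {1 2}/triple !insubT /mul /= eqxx.
Qed.

Lemma triple_mul_neq (a b c d : L) (s t : S) : b != c ->
  (triple a s b : B) * (triple c t d : B) = None :> B.
Proof.
move=> /negbTE bc; rewrite /triple.
by case: insubP => // u _ _; case: insubP => // v _ _; rewrite /mul /= bc.
Qed.

Context (Bext : topological_brandt_extension tau).

(** The corner (a, b) is reached from the corner (c, c) of the given embedding:
    (a, s, b) = (a, 1, c) (c, s, c) (c, 1, b). *)
Lemma triple_continuous (a b : L) : continuous (fun s : S => triple a s b : B).
Proof.
have [Bst [c [cc _]]] := Bext.
have ctr : continuous (fun s : S => triple c s c : B).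
  move=> s; apply: (@continuous_comp S (corner_space tau c c) B
    (corner_map tau c) set_val); first exact: cc.
  exact: initial_continuous.
have -> : (fun s : S => triple a s b : B) = (fun s : S =>
    (triple a 1 c : B) * (triple c s c : B) * (triple c 1 b : B)).
  by apply/funext => s; rewrite !tripleM mulg1 mul1g.
move=> s; apply: (@continuous_comp S B B (fun s => triple c s c)
  (fun x : B => (triple a 1 c : B) * x * (triple c 1 b : B))).
  exact: ctr.
exact: semitopological_translations.
Qed.

(** The two-sided translation by (a, 1, a) and (b, 1, b) fixes the corner (a, b)
    and sends everything else to 0; pull back the complement of 0. *)
Lemma open_corner_nonzero (a b : L) :
  open ([set Some (a, s, b) | s in [set: nonzero S]] : set B).
Proof.
have [Bst _] := Bext; have [hB _ _] := Bst.
have o0 : open (~` [set None : B]).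
  exact/closed_openC/accessible_closed_set1/hausdorff_accessible.
pose f (x : B) : B := (triple a 1 a : B) * x * (triple b 1 b : B).
have fc : continuous f by exact: semitopological_translations.
suff -> : [set Some (a, s, b) | s in [set: nonzero S]] = f @^-1` (~` [set None]).
  by apply: open_comp => // x _; exact: fc.
apply/seteqP; split=> [_ [s _ <-]|[[[c s] d]|]]; rewrite /preimage/= /f.
- by rewrite -triple_val !tripleM mul1g mulg1 triple_val.
- move=> fN; rewrite -triple_val in fN.
  have [ac|ac] := eqVneq a c; last by case: fN; rewrite triple_mul_neq.
  have [db|db] := eqVneq d b; first by exists s; rewrite // ac db.
  by case: fN; rewrite ac tripleM triple_mul_neq.
- by case; rewrite -(triple0 a b) !tripleM muls0 mul0s.
Qed.

Lemma triple_surjective (x : B) :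
  exists p : L * L, exists s : S, triple p.1 s p.2 = x.
Proof.
have [_ [c _]] := Bext.
case: x => [[[a s] b]|]; first by exists (a, b), (val s); exact: triple_val.
by exists (c, c), mzero; exact: triple0.
Qed.

(** Otherwise the nonempty open sets W p, the parts outside the closure of O of
    the exceptional corners, would accumulate somewhere: not at 0, since they
    miss O, and not at another point, since the nonzero part of its corner is a
    neighbourhood meeting only one of them. *)
Lemma finite_corner_not_closure (pB : pseudocompact B) (O : set B) :
  nbhs (None : B) O -> finite_set
    [set p : L * L | ~ range (fun s : S => triple p.1 s p.2 : B) `<=` closure O].
Proof.
move=> nO; apply: contrapT => Einf.
pose W (p : L * L) : set B :=
  [set Some (p.1, s, p.2) | s in [set: nonzero S]] `&` ~` closure O.
have [|x xacc] := pseudocompact_accumulation (V := W) pB Einf.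
  move=> p nsub; split.
    apply: openI; first exact: open_corner_nonzero.
    exact/closed_openC/closed_closure.
  move/existsNP: nsub => [y /not_implyP[[s _ <-] nOs]].
  exists (triple p.1 s p.2); split=> //.
  move: nOs; rewrite /triple; case: insubP => [u _ _ _|_ []]; first by exists u.
  exact: subset_closure (nbhs_singleton nO).
case: x xacc => [[[a s] b]|] xacc; last first.
  have /infinite_setN0[p [_ [y [[_ nOy] Oy]]]] := xacc _ nO.
  exact/nOy/subset_closure.
apply: (xacc [set Some (a, s, b) | s in [set: nonzero S]]).
  by apply: open_nbhs_nbhs; split; [exact: open_corner_nonzero|exists s].
apply: sub_finite_set (finite_set1 (a, b)) => -[c d] [_].
by move=> [_ [[[u _ <-] _] [v _ [-> _ ->]]]].
Qed.

End BrandtExtension.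

(** * The product theorem *)

Lemma semitopological_semigroup_prod (I : choiceType)
    (S : I -> preTopologicalSemigroupType) :
  (forall i, semitopological_semigroup (S i)) ->
  semitopological_semigroup (prod_topology S).
Proof.
move=> Ss; split.
- by apply: hausdorff_product => i; have [] := Ss i.
- move=> a; apply: continuous_into_product => i x.
  apply: (@continuous_comp (prod_topology S) (S i) (S i)
    (proj i) (fun y => a i * y)).
    exact: proj_continuous.
  by have [_ + _] := Ss i; apply.
- move=> a; apply: continuous_into_product => i x.
  apply: (@continuous_comp (prod_topology S) (S i) (S i)
    (proj i) (fun y => y * a i)).
    exact: proj_continuous.
  by have [_ _] := Ss i; apply.
Qed.

Theorem theorem2p24
    (I : choiceType) (L : I -> choiceType)
    (S : I -> preTopologicalMonoid0Type)
    (tau : forall i, topology_on (brandt (L i) (S i)))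
    (I_nonempty : inhabited I)
    (L_nonempty : forall i, inhabited (L i))
    (S_semitop : forall i, semitopological_semigroup (S i))
    (S_pseudocompact : forall i, pseudocompact (S i))
    (B_extension : forall i, topological_brandt_extension (tau i))
    (B_pseudocompact : forall i, pseudocompact (with_topology (tau i)))
    (prodS_pseudocompact : pseudocompact (prod_topology S)) :
  semitopological_semigroup (prod_topology (fun i => with_topology (tau i))) /\
  pseudocompact (prod_topology (fun i => with_topology (tau i))).
Proof.
split.
  by apply: semitopological_semigroup_prod => i; have [] := B_extension i.
pose h i (p : L i * L i) (s : S i) : with_topology (tau i) := triple p.1 s p.2.
apply: (pseudocompact_prod_charts (h := h) (x0 := fun i => None)).
- by move=> i p; exact: triple_continuous.
- by move=> i x; exact: triple_surjective.
- by move=> i O; exact: finite_corner_not_closure.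
- exact: prodS_pseudocompact.
Qed.
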